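(* Let $d>2$ and $n\geq d+2$ be integers. The following statements about the perfect number $N_{(n,d)}$ hold. (1) If $n=d+2$, then $$N_{(n,d)}=N_{(n,2)}=\begin{cases}k^2-k, & \text{if } n=2k;\\ k^2, & \text{if } n=2k+1.\end{cases}$$ (2) If $n>d+2$, then $$N_{(n,d)}\leq \sum_{i=5}^{n-d+2} N_{(i,2)}\binom{n-i-1}{d-3}+\sum_{j=3}^{d} N_{(j+2,2)}\binom{n-j-3}{d-j},$$ where $\binom{0}{0}=1$.
   Context: Let $K$ be a field and $S=K[x_1,\ldots,x_n]$. For an integer $e$, $sm(S)_e$ denotes the set of square-free monomials of degree $e$ in $S$ (empty if $e<0$ or $e>n$). For $A\subseteq sm(S)_d$ put $\sqcup(A)=\{g x_i \mid g\in A,\ 1\le i\le n,\ x_i\nmid g\}\subseteq sm(S)_{d+1}$ and $\sqcap(A)=\{g/x_i \mid g\in A,\ 1\le i\le n,\ x_i\mid g\}\subseteq sm(S)_{d-1}$. The set $A$ is upper perfect if $\sqcup(A)=sm(S)_{d+1}$ (every square-free monomial of degree $d+1$ is divisible by some element of $A$), and lower perfect if $\sqcap(A)=sm(S)_{d-1}$ (every square-free monomial of degree $d-1$ divides some element of $A$). An $(n,d)^{th}$ perfect set is a subset of $sm(S)_d$ that is both upper and lower perfect. The $(n,d)^{th}$ perfect number $N_{(n,d)}$ is the smallest cardinality of an $(n,d)^{th}$ perfect set. *)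

(* Defs.v *)
From mathcomp Require Import all_boot all_order all_algebra finmap.
From mathcomp Require Import boolp classical_sets.
From mathcomp Require Import mpoly.

Set Implicit Arguments.
Unset Strict Implicit.
Unset Printing Implicit Defensive.

Local Open Scope classical_set_scope.
Local Open Scope ring_scope.

Section PerfectSets.
Variables (K : fieldType) (n : nat).

Definition dvdX (i : 'I_n) (g : {mpoly K[n]}) : Prop :=
  exists h : {mpoly K[n]}, g = h * 'X_i.

(* The degree is an integer, so that [sm (-1)] is empty (with a natural
   predecessor it would be [sm 0 = {1}]). *)
Definition sm (e : int) : set {mpoly K[n]} :=
  [set g | exists m : 'X_{1..n},
     [/\ g = 'X_[K, m], forall i, (m i <= 1)%N & (mdeg m)%:Z = e]].

Definition sqcup (A : set {mpoly K[n]}) : set {mpoly K[n]} :=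
  [set h | exists g (i : 'I_n), [/\ A g, ~ dvdX i g & h = g * 'X_i]].

(* [h = g / x_i] is written [g = h * x_i], which includes [x_i | g] and
   determines [h] since [x_i] is not a zero divisor. *)
Definition sqcap (A : set {mpoly K[n]}) : set {mpoly K[n]} :=
  [set h | exists g (i : 'I_n), A g /\ g = h * 'X_i].

Definition upper_perfect (d : nat) (A : set {mpoly K[n]}) : Prop :=
  sqcup A = sm (d%:Z + 1).

Definition lower_perfect (d : nat) (A : set {mpoly K[n]}) : Prop :=
  sqcap A = sm (d%:Z - 1).

Definition perfect_set (d : nat) (A : {fset {mpoly K[n]}}) : Prop :=
  [/\ [set` A] `<=` sm d%:Z, upper_perfect d [set` A]
    & lower_perfect d [set` A]].

End PerfectSets.

Definition perfect_cards (K : fieldType) (n d : nat) : set nat :=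
  [set k | exists2 A : {fset {mpoly K[n]}}, perfect_set d A & #|` A| = k].

(* The default value 0 is reached only if there is no perfect set; for
   [d <= n] the whole of [sm d] is one. *)
Definition perfect_number (K : fieldType) (n d : nat) : nat :=
  xget 0%N [set k | perfect_cards K n d k /\
                    forall l, perfect_cards K n d l -> (k <= l)%N].

(* Main.v *)
Require Import Defs.
From mathcomp Require Import all_boot all_order all_algebra finmap.
From mathcomp Require Import boolp classical_sets.
From mathcomp Require Import mpoly.
From mathcomp Require Import fintype finset zify.

Local Open Scope nat_scope.

(** A square-free monomial is the set of variables dividing it, so a perfect set
is a family F of d-sets such that every (d+1)-set contains, and every (d-1)-set
lies in, a member of F.  Complementation exchanges the two conditions, whence
N(n, d) = N(n, n - d).  For d = 2 the upper condition says that the complement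
graph is triangle-free, so Mantel's theorem gives the lower bound, attained by
two disjoint cliques.  Splitting a family according to membership of one
variable gives N(n+1, d+1) <= N(n, d) + N(n, d+1); unrolling this recursion to
the boundary lines d = 2 and n = d + 2 counts lattice paths, which is the sum of
binomial coefficients in the second part. *)

(** * Perfect families of sets and complementation *)

(** Writing [#|B|.+1 = d] leaves the lower condition vacuous at [d = 0], matching the absence of
    monomials of degree -1. *)
Definition perfect_family (T : finType) (d : nat) (F : {set {set T}}) : Prop :=
  [/\ forall A, A \in F -> #|A| = d,
      forall B : {set T}, #|B| = d.+1 -> exists2 A, A \in F & A \subset B
    & forall B : {set T}, #|B|.+1 = d -> exists2 A, A \in F & B \subset A].

(** Ensures that the minimum defining a perfect number is taken over a nonempty set. *)
Lemma perfect_family_draws (T : finType) (d : nat) : d <= #|T| ->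
  perfect_family T d [set A : {set T} | #|A| == d]%SET.
Proof.
move=> dT; split=> [A|B cB|B cB]; first by rewrite inE => /eqP.
- have /card_gt0P[x xB] : 0 < #|B| by rewrite cB.
  exists (B :\ x); last exact: subD1set.
  by move: (cardsD1 x B); rewrite inE xB cB add1n => -[->].
- have /card_gt0P[x] : 0 < #|~: B| by rewrite cardsCs setCK; lia.
  rewrite inE => xB; exists (x |: B); last exact: subsetUr.
  by rewrite inE cardsU1 xB add1n cB.
Qed.

(** [A \subset ~: B] and [B \subset ~: A] are equivalent, so complementation turns each covering
    condition into the other. *)
Lemma perfect_family_setC (T : finType) (d : nat) (F : {set {set T}}) :
  d <= #|T| -> perfect_family T d F ->
  perfect_family T (#|T| - d) [set ~: A | A in F]%SET.
Proof.
move=> dT [cF uF lF]; split=> [_ /imsetP[A AF ->]|B cB|B cB].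
- by rewrite cardsCs setCK (cF A AF).
(* [max_card] rules out [d = 0], where [#|B|] would exceed [#|T|]. *)
- have [|A AF BA] := lF (~: B); first by have := max_card (mem B); rewrite cardsCs setCK cB; lia.
  by exists (~: A); [apply: imset_f | rewrite -setCS setCK].
- have [|A AF BA] := uF (~: B); first by rewrite cardsCs setCK; lia.
  by exists (~: A); [apply: imset_f | rewrite -setCS setCK].
Qed.

(** * Mantel's theorem and its extremal graphs *)

(* Mantel's bound for the complement graph: deleting the two ends of a
   non-edge loses an edge at each of the remaining vertices. *)
Lemma card_pairs_meeting_triples (T : finType) (F : {set {set T}}) (b k : nat)
    (V : {set T}) :
  (forall A, A \in F -> #|A| = 2) -> #|V| = b + 2 * k ->
  (forall B : {set T}, B \subset V -> #|B| = 3 ->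
     exists2 A, A \in F & A \subset B) ->
  k * k + b * k <= #|[set A in F | A \subset V]%SET| + k.
Proof.
move=> cF; elim: k V => [|k IHk] V cV uF; first by rewrite !muln0.
(* A non-edge xy works, since the triple of x, y, z contains an edge and that edge must pass through
   z. If all pairs in [V] are edges, any two vertices work. *)
have [x [y [xV yV xy noEdge]]] : exists x y, [/\ x \in V, y \in V, x != y &
    forall z, z \in V -> z != x -> z != y ->
      ([set x; z]%SET \in F) || ([set y; z]%SET \in F)].
  have [/existsP[x /existsP[y /and4P[xV yV xy xyF]]]|] := boolP
    [exists x, exists y, [&& x \in V, y \in V, x != y & [set x; y]%SET \notin F]].
    exists x, y; split=> // z zV zx zy.
    have [||A AF] := uF [set x; y; z]%SET.
    - by apply/subsetP=> t; rewrite !inE => /orP[/orP[]|] /eqP->.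
    - by rewrite setUC cardsU1 cards2 xy !inE negb_or zx zy.
    have /eqP/cards2P[p [q [pq AE]]] := cF A AF.
    subst A => /subsetP AS.
    have AF' : [set q; p]%SET \in F by rewrite setUC.
    have := AS p; have := AS q; rewrite !inE !eqxx /= ?orbT.
    move=> /(_ isT) /orP[/orP[]|] /eqP eq_q /(_ isT) /orP[/orP[]|] /eqP eq_p;
      move: pq AF AF'; rewrite {}eq_p {}eq_q ?eqxx // => _ AF AF';
      first [by rewrite ?AF ?AF' ?orbT | by rewrite ?AF ?AF' in xyF].
  move=> /existsPn allF; have /card_gt1P[x [y [xV yV xy]]] : 1 < #|V| by lia.
  exists x, y; split=> // z zV zx zy; apply/orP; left.
  move/existsPn: (allF x) => /(_ z).
  by rewrite xV zV eq_sym zx /= negbK.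
pose V' := V :\ x :\ y.
have cV' : #|V'| = b + 2 * k.
  move: (cardsD1 x V) (cardsD1 y (V :\ x)).
  by rewrite xV !inE eq_sym xy yV cV /V'; lia.
have sV' : V' \subset V by rewrite (subset_trans (subD1set _ _)) ?subD1set.
(* The edges [f z], for [z] in [V'], number [b + 2 * k], exactly the growth of the bound from [k] to
   [k.+1]. *)
pose f z := if [set x; z]%SET \in F then [set x; z]%SET else [set y; z]%SET.
have f_inj : {in V' &, injective f}.
  move=> z t; rewrite !inE => /and3P[zy zx zV] /and3P[ty tx tV] fzt.
  have : z \in f z by rewrite /f; case: ifP; rewrite !inE eqxx orbT.
  by rewrite fzt /f; case: ifP; rewrite !inE ?(negPf zx) ?(negPf zy) => _ /eqP.
have sF : [set A in F | A \subset V']%SET :|: f @: V'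
    \subset [set A in F | A \subset V]%SET.
  apply/subsetP=> A; rewrite !inE => /orP[/andP[-> AV']|/imsetP[z zV' ->]].
    exact: (subset_trans AV').
  move: zV'; rewrite !inE => /and3P[zy zx zV].
  have := noEdge z zV zx zy; rewrite /f; case: ifP => [-> _|_ /= ->];
    by apply/subsetP=> t; rewrite !inE => /orP[] /eqP->.
have dF : [disjoint [set A in F | A \subset V']%SET & f @: V'].
  rewrite disjoint_sym disjoints_subset; apply/subsetP=> _ /imsetP[z _ ->].
  rewrite !inE negb_and; apply/orP; right; apply/subsetPn; rewrite /f.
  by case: ifP => _; [exists x | exists y]; rewrite !inE ?eqxx ?andbF.
have := subset_leq_card sF; rewrite cardsU disjoint_setI0 // cards0 subn0.
rewrite (card_in_imset f_inj) cV'.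
have := IHk V' cV' (fun B BV' => uF B (subset_trans BV' sV')).
by set p := #|_|; set q := #|_|; lia.
Qed.

Lemma card_perfect_pairs (n b k : nat) (F : {set {set 'I_n}}) :
  n = b + 2 * k -> perfect_family 'I_n 2 F -> k * k + b * k <= #|F| + k.
Proof.
move=> nE [cF uF _].
have := @card_pairs_meeting_triples _ F b k [set: 'I_n] cF.
rewrite cardsT card_ord => /(_ nE (fun B _ => uF B)) /leq_trans; apply.
rewrite leq_add2r; apply: subset_leq_card.
by apply/subsetP=> A; rewrite inE => /andP[].
Qed.

(** By pigeonhole a triple has two points in [V] or two outside it; each point has a partner in its
    own part because both parts have at least two points. *)
Lemma perfect_pairs_within_parts (T : finType) (V : {set T}) :
  1 < #|V| -> 1 < #|~: V| ->
  perfect_family T 2 ([set A : {set T} | A \subset V & #|A| == 2]%SET :|: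
                      [set A : {set T} | A \subset ~: V & #|A| == 2]%SET).
Proof.
have half (W B : {set T}) : 1 < #|B :&: W| ->
    exists2 A, A \in [set A : {set T} | A \subset W & #|A| == 2]%SET & A \subset B.
  move=> /card_gt1P[x [y []]]; rewrite !inE => /andP[xB xW] /andP[yB yW] xy.
  exists [set x; y]%SET; last by apply/subsetP=> t; rewrite !inE => /orP[] /eqP->.
  rewrite inE cards2 xy andbT.
  by apply/subsetP=> t; rewrite !inE => /orP[] /eqP->.
have cover (W : {set T}) x : 1 < #|W| -> x \in W ->
    exists2 A, A \in [set A : {set T} | A \subset W & #|A| == 2]%SET & [set x]%SET \subset A.
  move=> W2 xW; have /card_gt0P[y] : 0 < #|W :\ x|.
    by move: (cardsD1 x W); rewrite xW; lia.
  rewrite !inE => /andP[yx yW]; exists [set x; y]%SET; last by rewrite sub1set !inE eqxx.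
  rewrite inE cards2 (eq_sym x) yx andbT.
  by apply/subsetP=> t; rewrite !inE => /orP[] /eqP->.
move=> V2 V'2; split=> [A|B cB|B [cB]].
- by rewrite !inE => /orP[] /andP[_ /eqP].
- have cBV := cardsID V B; rewrite setDE cB in cBV.
  have [BV|BV] := ltnP 1 #|B :&: V|.
    by have [A AF AB] := half V B BV; exists A; rewrite // inE AF.
  have [|A AF AB] := half (~: V) B; first by lia.
  by exists A; rewrite // inE AF orbT.
- have /cards1P[x ->] : #|B| == 1 by rewrite cB.
  have [xV|xV] := boolP (x \in V).
    by have [A AF AB] := cover V x V2 xV; exists A; rewrite // inE AF.
  have [|A AF AB] := cover (~: V) x V'2; first by rewrite inE.
  by exists A; rewrite // inE AF orbT.
Qed.

(** Two cliques on [k] and [k + b] points; for [b <= 1] the parts are balanced and Mantel's bound is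
    attained. *)
Lemma perfect_pairs_exist (b k : nat) : 1 < k ->
  exists2 F, perfect_family 'I_(b + 2 * k) 2 F & #|F| <= 'C(k, 2) + 'C(k + b, 2).
Proof.
move=> k1; pose V := [set i : 'I_(b + 2 * k) | i < k]%SET.
have cV : #|V| = k.
  have kn : k <= b + 2 * k by lia.
  have -> : V = [set widen_ord kn i | i in [set: 'I_k]]%SET.
    apply/setP=> i; rewrite inE; apply/idP/imsetP => [ik|[j _ ->] /=]; last exact: ltn_ord.
    by exists (Ordinal ik); [rewrite inE | apply/val_inj].
  by rewrite card_imset ?cardsT ?card_ord // => i j /(congr1 val) /= /val_inj.
have cV' : #|~: V| = k + b by rewrite cardsCs setCK card_ord cV; lia.
exists ([set A : {set _} | A \subset V & #|A| == 2]%SET :|: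
        [set A : {set _} | A \subset ~: V & #|A| == 2]%SET).
  by apply: perfect_pairs_within_parts; rewrite ?cV ?cV'; lia.
by apply: (leq_trans (leq_card_setU _ _)); rewrite !cards_draws cV cV'.
Qed.

(** * Adding one variable *)

(** A set containing the new point [ord0] is served by [F] with [ord0] adjoined, any other by a copy
    of [G]. *)
Lemma perfect_family_lift (n d : nat) (F G : {set {set 'I_n}}) :
  0 < d -> perfect_family 'I_n d F -> perfect_family 'I_n d.+1 G ->
  exists2 H, perfect_family 'I_n.+1 d.+1 H & #|H| <= #|F| + #|G|.
Proof.
move=> d0 [cF uF lF] [cG uG lG]; pose s := lift (@ord0 n).
have s_inj : injective s by apply: lift_inj.
have s0 (A : {set 'I_n}) : ord0 \notin s @: A.
  by apply/imsetP=> -[i _ /eqP]; rewrite (negPf (neq_lift _ _)).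
have s_preim (B : {set 'I_n.+1}) : B :\ ord0 = s @: (s @^-1: B).
  apply/setP=> i; rewrite !inE; case: (unliftP ord0 i) => [j|] ->.
    by rewrite eq_sym neq_lift mem_imset // inE.
  by rewrite eqxx (negPf (s0 _)).
have s_card (B : {set 'I_n.+1}) : #|B| = (ord0 \in B) + #|s @^-1: B|.
  by rewrite (cardsD1 ord0) s_preim card_imset.
exists ([set ord0 |: s @: A | A : {set _} in F]%SET :|: [set s @: A | A : {set 'I_n} in G]%SET);
  last by apply: (leq_trans (leq_card_setU _ _)); rewrite leq_add ?leq_imset_card.
split=> [_ /setUP[]/imsetP[A AF ->]|B cB|B [cB]].
- by rewrite cardsU1 s0 card_imset // cF.
- by rewrite card_imset // cG.
- rewrite s_card in cB; have [B0|B0] := boolP (ord0 \in B).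
    rewrite B0 in cB; case: cB => cB.
    have [A AF AB] := uF _ cB; exists (ord0 |: s @: A).
      by apply/setUP; left; apply/imsetP; exists A.
    by rewrite subUset sub1set B0 /= sub_imset_pre.
  rewrite (negPf B0) in cB; have [A AG AB] := uG _ cB.
  exists (s @: A); last by rewrite sub_imset_pre.
  by apply/setUP; right; apply/imsetP; exists A.
- rewrite s_card in cB; have [B0|B0] := boolP (ord0 \in B).
    rewrite B0 in cB; have [A AF AB] := lF _ cB; exists (ord0 |: s @: A).
      by apply/setUP; left; apply/imsetP; exists A.
    by rewrite -(setD1K B0) setUS // s_preim imsetS.
  rewrite (negPf B0) in cB.
  have [|A AG AB] := lG (s @^-1: B); first by rewrite -[d]cB.
  exists (s @: A).
    by apply/setUP; right; apply/imsetP; exists A.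
  have -> : B = B :\ ord0.
    by apply/setP=> i; rewrite !inE; case: eqP => // ->; rewrite (negPf B0).
  by rewrite s_preim imsetS.
Qed.

(** * Square-free monomials as sets of variables *)

Definition ind_mnm {n : nat} (A : {set 'I_n}) : 'X_{1..n} :=
  [multinom ((i \in A) : nat) | i < n].

Lemma ind_mnm_inj (n : nat) : injective (@ind_mnm n).
Proof.
move=> A B /mnmP AB; apply/setP=> i.
by have := AB i; rewrite !mnmE; case: (i \in A); case: (i \in B).
Qed.

Lemma mdeg_ind_mnm (n : nat) (A : {set 'I_n}) : mdeg (ind_mnm A) = #|A|.
Proof.
rewrite mdegE -sum1_card [RHS]big_mkcond; apply: eq_bigr => i _.
by rewrite mnmE; case: (i \in A).
Qed.

Definition sqfree_mon (K : fieldType) {n : nat} (A : {set 'I_n}) : {mpoly K[n]} :=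
  'X_[K, ind_mnm A]%R.

Lemma sqfree_mon_inj (K : fieldType) (n : nat) : injective (@sqfree_mon K n).
Proof.
move=> A B /(congr1 (mcoeff (ind_mnm A))); rewrite !mcoeffX eqxx.
by case: eqP => [/ind_mnm_inj-> //|_] /eqP; rewrite GRing.oner_eq0.
Qed.

Lemma sqfree_monU1 (K : fieldType) (n : nat) (i : 'I_n) (A : {set 'I_n}) :
  i \notin A -> sqfree_mon K (i |: A) = (sqfree_mon K A * 'X_i)%R.
Proof.
move=> iA; rewrite -mpolyXD; congr ('X_[_])%R; apply/mnmP => j.
rewrite mnmDE !mnmE !inE [in RHS]eq_sym; case: eqP => [->|_]; first by rewrite (negPf iA).
by rewrite addn0.
Qed.

(* Evaluate at the point whose only zero coordinate is the [i]-th one. *)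
Lemma dvdX_sqfree_mon (K : fieldType) (n : nat) (i : 'I_n) (A : {set 'I_n}) :
  dvdX i (sqfree_mon K A) <-> i \in A.
Proof.
split=> [[h]|iA]; last first.
  by exists (sqfree_mon K (A :\ i)); rewrite -sqfree_monU1 ?setD1K // !inE eqxx.
apply: contra_eqT => iA; apply/eqP => /(congr1 (meval (fun j => (j != i)%:R%R))).
rewrite mevalM mevalXU eqxx GRing.mulr0 mevalX big1 => [/eqP|j _].
  by rewrite GRing.oner_eq0.
rewrite mnmE; case: eqP => [->|_] /=; first by rewrite (negPf iA) GRing.expr0.
by rewrite GRing.expr1n.
Qed.

(** An exponent vector with entries at most 1 is the indicator of its support. *)
Lemma smP (K : fieldType) (n d : nat) (g : {mpoly K[n]}) :
  sm (Posz d) g <-> exists2 A : {set 'I_n}, #|A| = d & g = sqfree_mon K A.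
Proof.
split=> [[m [-> m1 [<-]]]|[A cA ->]].
  have mE : m = ind_mnm [set i | m i != 0]%SET.
    by apply/mnmP => i; rewrite mnmE inE; have := m1 i; case: (m i) => [|[]].
  by exists [set i | m i != 0]%SET; rewrite -?mdeg_ind_mnm -?mE // /sqfree_mon -mE.
exists (ind_mnm A); split=> [//|i|]; last by rewrite mdeg_ind_mnm cA.
by rewrite mnmE; case: (i \in A).
Qed.

(** Multiplying by a new variable always lands in degree [d + 1], so only the reverse inclusion has
    content; a set of size [d.+1] containing [A] is [A] with one point added. *)
Lemma sqcupP (K : fieldType) (n d : nat) (F : {set {set 'I_n}})
    (S : classical_sets.set {mpoly K[n]}) :
  (forall A, A \in F -> #|A| = d) ->
  (forall g, S g <-> exists2 A, A \in F & g = sqfree_mon K A) ->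
  sqcup S = sm (Posz d + 1)%R <->
  forall B : {set 'I_n}, #|B| = d.+1 -> exists2 A, A \in F & A \subset B.
Proof.
move=> cF SP; have -> : (Posz d + 1)%R = (Posz d.+1) by lia.
split=> [eqS B cB|uF].
  have : sm (Posz d.+1) (sqfree_mon K B) by apply/smP; exists B.
  rewrite -eqS => -[g [i [/SP[A AF ->] /dvdX_sqfree_mon/negP iA]]].
  rewrite -sqfree_monU1 // => /sqfree_mon_inj->.
  by exists A => //; apply: subsetUr.
apply/seteqP; split=> [h [g [i [/SP[A AF ->] /dvdX_sqfree_mon/negP iA ->]]]|h].
  by apply/smP; exists (i |: A); rewrite ?sqfree_monU1 // cardsU1 iA cF.
move=> /smP[B cB ->]; have [A AF AB] := uF B cB.
have /cards1P[i iE] : #|B :\: A| == 1.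
  by rewrite cardsD (setIidPr AB) cB cF // subSnn.
have iA : i \notin A by move/setP/(_ i): iE; rewrite !inE eqxx => /andP[].
exists (sqfree_mon K A), i; split; first by apply/SP; exists A.
  by move/dvdX_sqfree_mon; apply/negP.
by rewrite -sqfree_monU1 // -iE -{1}(setID B A) (setIidPr AB) setUC.
Qed.

Lemma sqcapP (K : fieldType) (n d : nat) (F : {set {set 'I_n}})
    (S : classical_sets.set {mpoly K[n]}) :
  0 < d -> (forall A, A \in F -> #|A| = d) ->
  (forall g, S g <-> exists2 A, A \in F & g = sqfree_mon K A) ->
  sqcap S = sm (Posz d - 1)%R <->
  forall B : {set 'I_n}, #|B|.+1 = d -> exists2 A, A \in F & B \subset A.
Proof.
case: d => // d _ cF SP; have -> : (Posz d.+1 - 1)%R = (Posz d) by lia.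
(* The variable is nonzero in an integral domain, so it cancels and the quotient by it is unique. *)
have divX (i : 'I_n) (A : {set 'I_n}) (h : {mpoly K[n]}) :
    sqfree_mon K A = (h * 'X_i)%R -> i \in A /\ h = sqfree_mon K (A :\ i).
  move=> hE; have iA : i \in A by apply/(dvdX_sqfree_mon K); exists h.
  split=> //; move: hE; rewrite -{1}(setD1K iA) sqfree_monU1 ?setD11 //.
  suff X0 : 'X_i%R != 0%R :> {mpoly K[n]} by move/(GRing.mulIf X0).
  apply/eqP => /(congr1 (mcoeff U_(i)%MM)); rewrite mcoeffX eqxx mcoeff0 => /eqP.
  by rewrite GRing.oner_eq0.
split=> [eqS B [cB]|lF].
  have : sm (Posz d) (sqfree_mon K B) by apply/smP; exists B.
  rewrite -eqS => -[g [i [/SP[A AF ->] /divX[iA /sqfree_mon_inj->]]]].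
  by exists A => //; apply: subD1set.
apply/seteqP; split=> [h [g [i [/SP[A AF ->] /divX[iA ->]]]]|h].
  apply/smP; exists (A :\ i) => //.
  by have := cardsD1 i A; rewrite iA (cF A AF) add1n => -[->].
move=> /smP[B cB ->]; have [|A AF BA] := lF B; first by rewrite cB.
have /cards1P[i iE] : #|A :\: B| == 1.
  by rewrite cardsD (setIidPr BA) cB cF // subSnn.
have iB : i \notin B by move/setP/(_ i): iE; rewrite !inE eqxx => /andP[].
exists (sqfree_mon K A), i; split; first by apply/SP; exists A.
by rewrite -sqfree_monU1 // -iE -{1}(setID A B) (setIidPr BA) setUC.
Qed.

(** * Perfect numbers as minima over set families *)

(** Since [sqfree_mon] is injective, passing between sets of monomials and families of sets
    preserves cardinality. *)
Lemma perfect_cardsP (K : fieldType) (n d k : nat) : 0 < d ->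
  perfect_cards K n d k <->
  exists2 F : {set {set 'I_n}}, perfect_family 'I_n d F & #|F| = k.
Proof.
move=> d0; split=> [[S [sS uS lS] <-]|[F [cF uF lF] <-]].
  pose F := [set A : {set 'I_n} | sqfree_mon K A \in S]%SET.
  have SP g : g \in S <-> exists2 A, A \in F & g = sqfree_mon K A.
    split=> [gS|[A]]; last by rewrite inE => ? ->.
    by have /smP[A _ gE] := sS g gS; exists A; rewrite // inE -gE.
  have cF A : A \in F -> #|A| = d.
    by rewrite inE => /sS/smP[B cB /sqfree_mon_inj->].
  exists F; first by split; [|apply/(sqcupP K n d F _ cF SP)
                             |apply/(sqcapP K n d F _ d0 cF SP)].
  have -> : S = [fset sqfree_mon K A | A in F]%fset.
    apply/fsetP=> g; apply/idP/imfsetP => [/SP[A]|[A AF ->]].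
      by exists A.
    by apply/SP; exists A.
  by rewrite card_imfset /= ?cardE //; apply: sqfree_mon_inj.
pose S := [fset sqfree_mon K A | A in F]%fset.
have SP g : [set` S]%classic g <-> exists2 A, A \in F & g = sqfree_mon K A.
  by split=> [/imfsetP[A]|[A AF gE]]; [exists A | apply/imfsetP; exists A].
exists S; last by rewrite card_imfset /= ?cardE //; apply: sqfree_mon_inj.
split; [|exact/(sqcupP K n d F _ cF SP)|exact/(sqcapP K n d F _ d0 cF SP)].
by move=> g /SP[A AF ->]; apply/smP; exists A; rewrite ?cF.
Qed.

Lemma perfect_numberP (K : fieldType) (n d : nat) : 0 < d -> d <= n ->
  (exists2 F, perfect_family 'I_n d F & #|F| = perfect_number K n d) /\
  (forall F, perfect_family 'I_n d F -> perfect_number K n d <= #|F|).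
Proof.
move=> d0 dn; have exN : exists k, `[< perfect_cards K n d k >].
  exists #|[set A : {set 'I_n} | #|A| == d]%SET|; apply/asboolP.
  apply/perfect_cardsP => //; eexists; last by [].
  by apply: perfect_family_draws; rewrite card_ord.
(* A least cardinality exists, so [xget] does not fall back on its default 0. *)
have [|/(perfect_cardsP _ _ _ _ d0) Nmem Nmin] := @xgetPex _ 0
    (fun k => perfect_cards K n d k /\ forall l, perfect_cards K n d l -> k <= l).
  case: (ex_minnP exN) => k /asboolP Pk mink; exists k; split=> // l Pl.
  by apply: mink; apply/asboolP.
by split=> [//|F pF]; apply: Nmin; apply/perfect_cardsP => //; exists F.
Qed.

(** The complements of a minimal family for [d] form a perfect family for [e] of no larger size;
    exchanging [d] and [e] will give equality. *)
Lemma perfect_number_le_compl (K : fieldType) (n d e : nat) :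
  0 < d -> 0 < e -> n = d + e -> perfect_number K n e <= perfect_number K n d.
Proof.
move=> d0 e0 nE; have [|[F pF <-] _] := perfect_numberP K n d d0; first by lia.
have [|_ minN] := perfect_numberP K n e e0; first by lia.
apply: leq_trans (leq_imset_card (fun A => ~: A) F); apply: minN.
have -> : e = #|'I_n| - d by rewrite card_ord; lia.
by apply: perfect_family_setC; rewrite // card_ord; lia.
Qed.

Lemma perfect_number_compl (K : fieldType) (n d e : nat) :
  0 < d -> 0 < e -> n = d + e -> perfect_number K n d = perfect_number K n e.
Proof.
move=> d0 e0 nE; apply/eqP; rewrite eqn_leq.
by rewrite !(perfect_number_le_compl K n) // addnC.
Qed.

(** Here [b] is the parity of the number of variables; adding [k] on the left avoids truncated
    subtraction. *)
Lemma perfect_number2 (K : fieldType) (b k : nat) : b <= 1 -> 1 < k ->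
  perfect_number K (b + 2 * k) 2 + k = k * k + b * k.
Proof.
move=> b1 k1; have [|[F pF FE] minN] := perfect_numberP K (b + 2 * k) 2 isT.
  by lia.
apply/eqP; rewrite eqn_leq -{2}FE (card_perfect_pairs _ b k F) // andbT.
have [G pG] := perfect_pairs_exist b k k1.
move/(leq_trans (minN G pG)); rewrite -(leq_add2r k) => /leq_trans; apply.
(* Doubling the binomials turns the size of the two cliques into a polynomial in [k]. *)
have E m : 'C(m, 2) * 2 = m * m.-1.
  by elim: m => // m IHm; rewrite binS bin1 mulnDl IHm; case: m {IHm} => //= m; nia.
by have := E k; have := E (k + b); case: b b1 {minN F pF FE G pG} => [|[|//]] _;
  case: k k1 => //= k _; nia.
Qed.

Lemma perfect_number_rec (K : fieldType) (n d : nat) : 0 < d -> d < n ->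
  perfect_number K n.+1 d.+1 <= perfect_number K n d + perfect_number K n d.+1.
Proof.
move=> d0 dn; have [|[F pF <-] _] := perfect_numberP K n d d0; first exact: ltnW.
have [[G pG <-] _] := perfect_numberP K n d.+1 isT dn.
have [|_ minN] := perfect_numberP K n.+1 d.+1 isT; first exact: leqW.
have [H pH] := perfect_family_lift n d F G d0 pF pG.
by apply: leq_trans; apply: minN.
Qed.

(** * Lattice-path sums for Pascal-type recursions *)

(** ['C(e + m - i, e)] counts the lattice paths from (e, m) to (0, i) with steps lowering one
    coordinate by 1; a last step leaves through the line e = -1 with weight [a i]. *)
Definition path_sum (a : nat -> nat) (e m : nat) :=
  \sum_(i < m.+1) a i * 'C(e + m - i, e).

Lemma path_sum0S a m : path_sum a 0 m.+1 = path_sum a 0 m + a m.+1.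
Proof.
rewrite /path_sum big_ord_recr bin0 muln1; congr (_ + _).
by apply: eq_bigr => i _; rewrite !bin0.
Qed.

Lemma path_sumn0 a e : path_sum a e 0 = a 0.
Proof. by rewrite /path_sum big_ord1 addn0 subn0 binn muln1. Qed.

Lemma path_sumSS a e m :
  path_sum a e.+1 m.+1 = path_sum a e m.+1 + path_sum a e.+1 m.
Proof.
(* The added term [i = m.+1] vanishes, since ['C(e, e.+1) = 0]; the ranges then agree for Pascal's
   rule. *)
have -> : path_sum a e.+1 m = \sum_(i < m.+2) a i * 'C(e + m.+1 - i, e.+1).
  rewrite big_ord_recr /= addnK bin_small // muln0 addn0.
  by apply: eq_bigr => i _; rewrite addSnnS.
rewrite -big_split; apply: eq_bigr => i _ /=; rewrite -mulnDr.
by rewrite addSn subSn ?binS 1?addnC //; have := ltn_ord i; lia.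
Qed.

(* A bound obeying Pascal's recursion is a sum over the lattice paths from
   (e, m) to the boundary. *)
Lemma pascal_bound (N : nat -> nat -> nat) (a : nat -> nat) :
  N 0 0 <= a 0 + a 0 ->
  (forall m, N 0 m.+1 <= a m.+1 + N 0 m) ->
  (forall e, N e.+1 0 <= N e 0 + a e.+1) ->
  (forall e m, N e.+1 m.+1 <= N e m.+1 + N e.+1 m) ->
  forall e m, N e m <= path_sum a e m + path_sum a m e.
Proof.
move=> N00 N0S NS0 NSS; elim=> [|e IHe]; elim=> [|m IHm].
- by rewrite !path_sumn0.
- apply: (leq_trans (N0S m)); move: IHm.
  by rewrite path_sum0S !path_sumn0; lia.
- apply: (leq_trans (NS0 e)); move: (IHe 0).
  by rewrite path_sum0S !path_sumn0; lia.
- apply: (leq_trans (NSS e m)); move: (IHe m.+1) IHm.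
  by rewrite !path_sumSS; lia.
Qed.

(** * Values on the line n = d + 2 and the bound beyond it *)

Theorem theorem5p1 (K : fieldType) (n d : nat) (hd : 2 < d) (hn : d + 2 <= n) :
  (n = d + 2 ->
     perfect_number K n d = perfect_number K n 2 /\
     (forall k, n = 2 * k -> perfect_number K n 2 = k ^ 2 - k) /\
     (forall k, n = 2 * k + 1 -> perfect_number K n 2 = k ^ 2)) /\
  (d + 2 < n ->
     perfect_number K n d <=
       \sum_(5 <= i < (n - d + 2).+1)
          perfect_number K i 2 * 'C(n - i - 1, d - 3) +
       \sum_(3 <= j < d.+1)
          perfect_number K (j + 2) 2 * 'C(n - j - 3, d - j)).
Proof.
split=> [nE|dn].
  split; first by apply: perfect_number_compl => //; lia.
  (* Here [n] is at least 5, which forces [1 < k] in both parities. *)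
  split=> k kE.
    by have := perfect_number2 K 0 k isT; rewrite add0n -kE mulnn; lia.
  have := perfect_number2 K 1 k isT; rewrite [1 + _]addnC -kE mulnn; lia.
(* With [d = e + 3] and [n = e + m + 6], the lines d = 2 and n = d + 2 become e = -1 and m = -1, and
   both carry the values [a]. *)
pose a i := perfect_number K (i + 5) 2.
pose N e m := perfect_number K (e + m + 6) (e + 3).
have [e dE] : exists e, d = e + 3 by exists (d - 3); lia.
have [m nE] : exists m, n = e + m + 6 by exists (n - e - 6); lia.
have boundary i : perfect_number K (i + 5) (i + 3) = a i.
  by apply: perfect_number_compl => //; lia.
have : N e m <= path_sum a e m + path_sum a m e.
  apply: pascal_bound => [|m'|e'|e' m'].
  - by rewrite -{2}(boundary 0); apply: perfect_number_rec.
  - rewrite /N /a; have -> : 0 + m'.+1 + 6 = (m'.+1 + 5).+1 by lia.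
    have -> : 0 + m' + 6 = m'.+1 + 5 by lia.
    by apply: perfect_number_rec => //; lia.
  - rewrite -boundary /N; have -> : e'.+1 + 0 + 6 = (e'.+1 + 5).+1 by lia.
    have -> : e' + 0 + 6 = e'.+1 + 5 by lia.
    by rewrite [e'.+1 + 3]addSn; apply: perfect_number_rec => //; lia.
  - rewrite /N; have -> : e'.+1 + m'.+1 + 6 = (e'.+1 + m' + 6).+1 by lia.
    have -> : e' + m'.+1 + 6 = e'.+1 + m' + 6 by lia.
    by rewrite [e'.+1 + 3]addSn; apply: perfect_number_rec => //; lia.
rewrite /N -nE -dE => /leq_trans; apply; rewrite leq_add //.
  rewrite -{1}[5]add0n big_addn big_mkord.
  have -> : (n - d + 2).+1 - 5 = m.+1 by lia.
  apply/eq_leq/eq_bigr => i _; congr (_ * 'C(_, _)); lia.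
rewrite -{1}[3]add0n big_addn big_mkord.
have -> : d.+1 - 3 = e.+1 by lia.
apply/eq_leq/eq_bigr => i _; rewrite /a -addnA; congr (_ * _).
have -> : n - (i + 3) - 3 = m + e - i by lia.
(* Symmetry of binomials trades the lower index [e - i] of the stated sum for the [m] of
   [path_sum]. *)
have -> : d - (i + 3) = m + e - i - m by have := ltn_ord i; lia.
by rewrite bin_sub //; have := ltn_ord i; lia.
Qed.
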